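(* Let $G=(V,E)$ be a connected graph. Then $\operatorname{gon}(G)\geq \operatorname{tw}(G)$, where $\operatorname{gon}(G)$ is the (divisorial) gonality of $G$ and $\operatorname{tw}(G)$ is its treewidth.
   Context: Graphs are finite and undirected, with nonempty vertex set; parallel edges are allowed, loops are not. Let $G=(V,E)$ be a connected graph. For $u\ne v$ let $E(u,v)$ be the set of edges between $u$ and $v$. The Laplacian $Q(G)\in\mathbb{Z}^{V\times V}$ has $Q_{vv}=$ degree of $v$ and $Q_{uv}=-|E(u,v)|$ for $u\neq v$. A divisor on $G$ is a vector $D\in\mathbb{Z}^V$; its degree is $\deg(D)=\sum_{v\in V}D(v)$; it is effective if $D\ge 0$. Divisors $D,D'$ are equivalent, $D\sim D'$, if $D-D'=Q(G)x$ for some $x\in\mathbb{Z}^V$. The rank of $D$ is the largest integer $k$ such that $D-D'$ is equivalent to an effective divisor for every effective divisor $D'$ of degree $k$ (and $-1$ if $D$ is not equivalent to an effective divisor). Thus $D$ has positive rank if and only if for every $v\in V$ there is an effective divisor $D''\sim D$ with $D''(v)\ge 1$. The gonality is $$\operatorname{gon}(G)=\min\{k : \text{there is a divisor of degree } k \text{ on } G \text{ with positive rank}\}.$$ A (simple) graph $H$ is chordal if it has no induced cycle of length at least $4$. A chordal extension of $G=(V,E)$ is a chordal graph $H$ on the same vertex set $V$ in which any two vertices adjacent in $G$ are adjacent. With $\omega(H)$ the maximum size of a clique in $H$, the treewidth is $\operatorname{tw}(G)=-1+\min\{\omega(H) : H \text{ is a chordal extension of } G\}$. *)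

(* Defs.v *)
From mathcomp Require Import all_boot all_order all_algebra.
From mathcomp Require Import boolp.

Set Implicit Arguments.
Unset Strict Implicit.
Unset Printing Implicit Defensive.

Import Order.TTheory GRing.Theory Num.Theory.
Local Open Scope ring_scope.

(* Finite undirected multigraphs: [ends e] is the set of endpoints of the edge
   [e]; requiring exactly two of them rules out loops, while [ends] need not be
   injective, so that parallel edges are allowed. *)
Record multigraph := Multigraph {
  vertex : finType;
  edge : finType;
  ends : edge -> {set vertex};
  card_ends : forall e, #|ends e| = 2%N;
  card_vertex_gt0 : (0 < #|vertex|)%N
}.

Section Divisors.
Variable G : multigraph.
Implicit Types (u v : vertex G) (e : edge G).

Definition edges u v : {set edge G} := [set e | ends e == [set u; v]].

Definition degree v : nat := #|[set e | v \in ends e]|.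

Definition adjacent : rel (vertex G) := [rel u v | edges u v != set0].

Definition connected : Prop := forall u v, connect adjacent u v.

Definition laplacian u v : int :=
  if u == v then (degree v)%:Z else - #|edges u v|%:Z.

Definition divisor := {ffun vertex G -> int}.
Implicit Types D : divisor.

Definition deg D : int := \sum_v D v.

Definition effective D : Prop := forall v, 0 <= D v.

Definition equivalent D D' : Prop :=
  exists x : {ffun vertex G -> int},
    forall v, (D - D') v = \sum_u laplacian v u * x u.

Definition equiv_effective D : Prop :=
  exists2 D', equivalent D D' & effective D'.

Definition rank_at_least D (k : nat) : Prop :=
  forall D', effective D' -> deg D' = k%:Z -> equiv_effective (D - D').

Lemma laplacian_col_sum u : \sum_v laplacian v u = 0.
Proof.
rewrite (bigD1 u) //= /laplacian eqxx.
rewrite (eq_bigr (fun v => - #|edges v u|%:Z)); last first.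
  by move=> v /negbTE ->.
rewrite sumrN -(big_morph Posz PoszD (erefl _)); apply/eqP; rewrite subr_eq0; apply/eqP; congr (_%:Z).
rewrite /degree -sum1_card.
under [in RHS]eq_bigr => v _ do rewrite -sum1_card big_mkcond /=.
rewrite exchange_big /= big_mkcond /=; apply: eq_bigr => e _.
rewrite inE; case: ifPn => ue; last first.
  rewrite big1 // => v _; rewrite inE; case: eqP => // E.
  by rewrite E !inE eqxx orbT in ue.
have /eqP/cards2P [a [b [ab E]]] := card_ends e.
have [w wu Ew] : exists2 w, w != u & ends e = [set w; u].
  move: ue; rewrite E !inE => /orP[] /eqP ->; last by exists a.
  by exists b; rewrite 1?eq_sym // setUC.
rewrite (bigD1 w) //= inE Ew eqxx big1 // => v /andP[vu vw].
rewrite inE Ew; case: eqP => // /setP /(_ v).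
by rewrite !inE eqxx (negbTE vu) (negbTE vw).
Qed.

Lemma deg_sub D D' : deg (D - D') = deg D - deg D'.
Proof. by rewrite /deg -sumrB; apply: eq_bigr => v _; rewrite !ffunE. Qed.

Lemma deg_equivalent D D' : equivalent D D' -> deg D = deg D'.
Proof.
case=> x E; apply/eqP; rewrite -subr_eq0 -deg_sub /deg.
under eq_bigr => v _ do rewrite E.
rewrite exchange_big big1 // => u _.
by rewrite -mulr_suml laplacian_col_sum mul0r.
Qed.

Lemma deg_equiv_effective D : equiv_effective D -> 0 <= deg D.
Proof.
by case=> D' /deg_equivalent -> D'0; apply: sumr_ge0 => v _; apply: D'0.
Qed.

Lemma equivalent_refl D : equivalent D D.
Proof.
exists 0 => v; rewrite subrr ffunE big1 // => u _.
by rewrite ffunE mulr0.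
Qed.

Lemma rank_at_least0 D : equiv_effective D -> exists k, `[< rank_at_least D k >].
Proof.
move=> eD; exists 0%N; apply/asboolP => D' D'0 /eqP.
rewrite psumr_eq0 => [/allP D'E|v _]; last exact: D'0.
suff -> : D' = 0 by rewrite subr0.
by apply/ffunP => v; rewrite ffunE; apply/eqP/D'E; rewrite mem_index_enum.
Qed.

Lemma rank_at_least_bound D k :
  `[< rank_at_least D k >] -> (k <= `|deg D|)%N.
Proof.
move=> /asboolP Dk.
have /card_gt0P [v0 _] := card_vertex_gt0 G.
pose D' : divisor := [ffun v => if v == v0 then k%:Z else 0].
have degD' : deg D' = k%:Z.
  rewrite /deg (bigD1 v0) //= ffunE eqxx big1 ?addr0 // => v /negbTE vv0.
  by rewrite ffunE vv0.
have D'0 : effective D' by move=> v; rewrite ffunE; case: ifP.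
have := deg_equiv_effective (Dk D' D'0 degD').
rewrite deg_sub degD' subr_ge0 => kD.
by rewrite -lez_nat (le_trans kD) // abszE ler_norm.
Qed.

Definition rank D : int :=
  if pselect (equiv_effective D) is left eD then
    (ex_maxn (rank_at_least0 eD) (@rank_at_least_bound D))%:Z
  else -1.

Lemma rank_ge1 D : rank_at_least D 0 -> rank_at_least D 1 -> 0 < rank D.
Proof.
move=> D0 D1; rewrite /rank; case: pselect => [eD|[]].
  by case: ex_maxnP => k _ /(_ 1%N); rewrite ltz_nat; apply; apply/asboolP.
rewrite -[D]subr0; apply: D0 => [v|]; first by rewrite ffunE.
by rewrite /deg big1 // => v _; rewrite ffunE.
Qed.

Lemma rank_gt0_deg_ge0 D : 0 < rank D -> 0 <= deg D.
Proof.
by rewrite /rank; case: pselect => // eD _; apply: deg_equiv_effective.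
Qed.

Lemma exists_rank_gt0 :
  exists k : nat, `[< exists2 D, deg D = k%:Z & 0 < rank D >].
Proof.
pose D : divisor := [ffun=> 1].
have DD' D' k : (k <= 1)%N -> effective D' -> deg D' = k%:Z ->
    equiv_effective (D - D').
  move=> k1 D'0 D'k; exists (D - D'); first exact: equivalent_refl.
  move=> v; rewrite !ffunE subr_ge0.
  have : D' v <= deg D'.
    by rewrite /deg (bigD1 v) //= lerDl sumr_ge0 // => u _; apply: D'0.
  by move/le_trans; apply; rewrite D'k lez_nat.
exists #|vertex G|; apply/asboolP; exists D.
  rewrite /deg; under eq_bigr => v _ do rewrite ffunE.
  by rewrite sumr_const -natz.
by apply: rank_ge1 => D'; apply: DD'.
Qed.

(* By [rank_gt0_deg_ge0], minimizing over natural numbers rather than over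
   integers loses nothing. *)
Definition gonality : nat := ex_minn exists_rank_gt0.

End Divisors.

Section Chordal.
Variable V : finType.
Implicit Type H : rel V.

Definition simple_graph H : Prop := symmetric H /\ irreflexive H.

(* [ordS] is the cyclic successor on ['I_n]. *)
Definition induced_cycle H (n : nat) (c : 'I_n -> V) : Prop :=
  injective c /\
  forall i j : 'I_n, H (c i) (c j) = (j == ordS i) || (i == ordS j).

Definition chordal H : Prop :=
  forall (n : nat) (c : 'I_n -> V), (4 <= n)%N -> ~ induced_cycle H c.

Definition clique H (A : {set V}) : bool :=
  [forall u in A, forall v in A, (u != v) ==> H u v].

Definition clique_number H : nat := \max_(A : {set V} | clique H A) #|A|.

End Chordal.

Section Treewidth.
Variable G : multigraph.

Definition chordal_extension (H : rel (vertex G)) : Prop :=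
  [/\ simple_graph H, chordal H & forall u v, adjacent u v -> H u v].

Lemma complete_chordal_extension :
  chordal_extension (fun u v : vertex G => u != v).
Proof.
split.
- by split=> [u v|u]; rewrite ?eqxx // eq_sym.
- move=> [|[|[|[|n]]]] // c _ [cI /(_ (inord 0) (inord 2))].
  rewrite (inj_eq cI) -!val_eqE /= !inordK //.
- move=> u v /set0Pn [e]; rewrite inE => /eqP E; apply/eqP => uv.
  by have := card_ends e; rewrite E uv setUid cards1.
Qed.

Lemma exists_chordal_extension :
  exists k : nat,
    `[< exists2 H, chordal_extension H & clique_number H = k >].
Proof.
eexists; apply/asboolP; eexists; [exact: complete_chordal_extension | by []].
Qed.

Definition treewidth : int := -1 + (ex_minn exists_chordal_extension)%:Z.

End Treewidth.

(* Main.v *)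
Require Import Defs.
From mathcomp Require Import all_boot all_order all_algebra.
From mathcomp Require Import boolp zify.
Local Open Scope ring_scope.

Set Implicit Arguments.
Unset Strict Implicit.
Unset Printing Implicit Defensive.
Import Order.TTheory GRing.Theory Num.Theory.

(* A linear order on the vertices yields a chordal extension, the fill-in graph:
   u < v are joined if u is a neighbour of the component of v in the graph
   induced on the vertices from v onwards. Its cliques have at most k + 1
   vertices as soon as these components have at most k neighbours each.

   Such an order is found by searching the graph with the k chips of a positive
   rank divisor. Let C be the set of vertices still to be ordered, D an effective
   divisor of the class with a chip on every neighbour of C, and q in C. If some
   vertex of C has a chip, put it next. Otherwise let D' ~ D be effective with
   D'(q) > 0, write D' = D - Q x, and let U be the set where x is maximal, so
   that D - Q 1_U is effective and q is not in U. If U meets C then, since C has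
   no chips, no edge joins C :&: U to C :\: U, and the two parts can be ordered
   separately. Otherwise put next the vertices of C adjacent to U, in any order:
   the chips crossing the cut pay for these vertices and for their neighbours in
   U. Then continue with D - Q 1_U, which is strictly closer to D' when no vertex
   of C is adjacent to U. *)

(** * Vertex orders whose final segments have few neighbours *)

Section Elimination.
Variables (T : finType) (e : rel T).
Implicit Types (u v w x y : T) (s t : seq T) (K C : {set T}).

Definition nbr K : {set T} := [set w | (w \notin K) && [exists u in K, e u w]].

Lemma nbrP K w :
  reflect (w \notin K /\ exists2 u, u \in K & e u w) (w \in nbr K).
Proof.
rewrite inE; apply: (iffP andP) => -[wK].
  by move=> /existsP[u /andP[]]; split=> //; exists u.
by case=> u uK euw; split=> //; apply/existsP; exists u; rewrite uK.
Qed.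

(* [K] is a union of components of the graph induced on [s], one of them
   containing [v]. *)
Fixpoint narrow (k : nat) s : Prop :=
  if s is v :: t then
    (exists K, [/\ v \in K, {subset K <= s}, {in nbr K, forall w, w \notin s}
                 & (#|nbr K| <= k)%N]) /\ narrow k t
  else True.

Lemma narrow_cat k s t : {in s & t, forall u v, ~~ e u v} ->
  narrow k s -> narrow k t -> narrow k (s ++ t).
Proof.
elim: s => //= a s IH st [[K [aK Ks Kn Kk]] ns] nt; split; last first.
  by apply: IH => // u v us; apply: st; rewrite inE us orbT.
exists K; split=> // [x /Ks|w wK]; first by rewrite -cat_cons mem_cat => ->.
rewrite -cat_cons mem_cat negb_or Kn //=; apply/negP => wt.
by have /nbrP[_ [u /Ks us]] := wK; apply/negP/st.
Qed.

(** Each vertex of [s] takes as its set the whole suffix that starts at it, which lies between [t]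
    and [s ++ t]. *)
Lemma narrow_prepend k s t :
  (forall K, {subset t <= K} -> {subset K <= s ++ t} -> #|nbr K| <= k)%N ->
  narrow k t -> narrow k (s ++ t).
Proof.
elim: s => //= a s IH Hk nt; split; last first.
  by apply: IH => // K tK Ks; apply: Hk => // x /Ks xs; rewrite inE xs orbT.
exists [set x in a :: s ++ t]; split.
- by rewrite !inE eqxx.
- by move=> x; rewrite inE.
- by move=> w; rewrite !inE => /andP[].
- by apply: Hk => x; rewrite !inE ?mem_cat // => ->; rewrite !orbT.
Qed.

Lemma narrow_index k s v : uniq s -> narrow k s -> v \in s ->
  exists K, [/\ v \in K, {subset K <= s},
    {in K, forall x, index v s <= index x s}%N,
    {in nbr K, forall w, w \in s -> index w s < index v s}%N
    & (#|nbr K| <= k)%N].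
Proof.
elim: s => //= a s IH /andP[as_ us] [[K [aK Ks Kn Kk]] ns].
rewrite inE; case: (eqVneq v a) => [->|va] vs.
  by exists K; split=> // w /Kn/negbTE ->.
have [{Ks Kn Kk aK}K [vK Ks Kv Kn Kk]] := IH us ns vs.
exists K; split=> // [x xK|x xK|w wK]; first by rewrite inE Ks ?orbT.
  case: eqVneq => [ax|_]; last by rewrite ltnS Kv.
  by rewrite ax Ks in as_.
rewrite inE eq_sym; case: eqVneq => //= _ ws.
by rewrite ltnS Kn.
Qed.

(** * The fill-in graph of an order *)

Section FillIn.
Variables (k : nat) (s : seq T).
Hypotheses (e_sym : symmetric e) (e_irr : irreflexive e).
Hypotheses (s_uniq : uniq s) (s_all : forall v, v \in s).
Hypothesis s_narrow : narrow k s.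

Definition later v : rel T := fun x y =>
  [&& e x y, index v s <= index x s & index v s <= index y s]%N.

Definition reach v : {set T} := [set x | connect (later v) v x].

(* The fill-in graph of the elimination of the vertices in the reverse order
   of [s]. *)
Definition fill_up u v := (index u s < index v s)%N && (u \in nbr (reach v)).
Definition fill : rel T := fun u v => fill_up u v || fill_up v u.

Lemma later_sym v : connect_sym (later v).
Proof.
by apply: sym_connect_sym => x y; rewrite /later e_sym (andbC (_ <= _)%N).
Qed.

Lemma reach_refl v : v \in reach v.
Proof. by rewrite inE. Qed.

Lemma reach_later v x : x \in reach v -> (index v s <= index x s)%N.
Proof.
rewrite inE => /(closed_connect (a := [pred x | index v s <= index x s]%N)).
rewrite !inE leqnn => H; rewrite -H //.
apply: intro_closed; first exact: later_sym.
by move=> a b /and3P[].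
Qed.

Lemma reach_step v x y : x \in reach v -> e x y -> (index v s <= index y s)%N ->
  y \in reach v.
Proof.
move=> xv exy vy; have vx := reach_later xv; move: xv; rewrite !inE => xv.
by apply: connect_trans xv (connect1 _); rewrite /later exy vx.
Qed.

Lemma reach_nbr_earlier v w : w \in nbr (reach v) -> (index w s < index v s)%N.
Proof.
case/nbrP=> wv [x xv exw]; rewrite ltnNge; apply/negP => vw.
by rewrite (reach_step xv exw vw) in wv.
Qed.

(** The set [K] of [narrow_index] is closed under [later v], so it contains [reach v]. A neighbour
    of [reach v] comes before [v], hence lies outside [K] and is a neighbour of [K] as well. *)
Lemma card_nbr_reach v : (#|nbr (reach v)| <= k)%N.
Proof.
have [K [vK Ks Kv Kn Kk]] := narrow_index s_uniq s_narrow (s_all v).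
have rK : {subset reach v <= K}.
  move=> x; rewrite inE => /(closed_connect (a := mem K)) /=.
  rewrite vK => <- //; apply: intro_closed; first exact: later_sym.
  move=> a b /and3P[eab _ vb] /= aK; apply/negPn/negP => bK.
  have /Kn : b \in nbr K by apply/nbrP; split=> //; exists a.
  by rewrite ltnNge vb => /(_ (s_all b)).
apply: leq_trans Kk; apply/subset_leq_card/subsetP => w wN.
have wv := reach_nbr_earlier wN; have [_ [x /rK xK exw]] := nbrP _ _ wN.
apply/nbrP; split; last by exists x.
by apply/negP => /Kv; rewrite leqNgt wv.
Qed.

Lemma index_neq u v :
  u != v -> (index u s < index v s)%N || (index v s < index u s)%N.
Proof.
apply: contraNT; rewrite negb_or -!leqNgt => /andP[vu uv]; apply/eqP.
have /eqP : index u s = index v s by apply/eqP; rewrite eqn_leq uv vu.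
by move/eqP/(congr1 (nth u s)); rewrite !nth_index.
Qed.

Lemma fill_simple : simple_graph fill.
Proof.
split=> [u v|u]; first by rewrite /fill orbC.
by rewrite /fill /fill_up ltnn.
Qed.

Lemma fill_extends u v : e u v -> fill u v.
Proof.
have up x y : e x y -> (index x s < index y s)%N -> fill_up x y.
  move=> exy xy; rewrite /fill_up xy; apply/nbrP; split.
    by apply/negP => /reach_later; rewrite leqNgt xy.
  by exists y; rewrite ?reach_refl // e_sym.
move=> euv; have uv : u != v by apply: contraTneq euv => ->; rewrite e_irr.
rewrite /fill; case/orP: (index_neq uv) => H; first by rewrite up.
by rewrite orbC up // e_sym.
Qed.

Lemma fill_last u v : fill u v ->
  (index u s <= index v s)%N -> u \in nbr (reach v).
Proof.
case/orP=> /andP[] // vu _; by rewrite leqNgt vu.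
Qed.

(** If [x] comes before [y], then [reach v], which has an edge to [y] and lies after it, is part of
    [reach y]; so [x] is a neighbour of [reach y]. *)
Lemma fill_nbr v a b : a \in nbr (reach v) -> b \in nbr (reach v) -> a != b ->
  fill a b.
Proof.
suff up x y : x \in nbr (reach v) -> y \in nbr (reach v) ->
    (index x s < index y s)%N -> fill_up x y.
  move=> av bv /index_neq/orP[] H; rewrite /fill; first by rewrite up.
  by rewrite orbC up.
move=> xN yN xy; rewrite /fill_up xy /=.
have yv := reach_nbr_earlier yN.
have [_ [p pv epx]] := nbrP _ _ xN; have [_ [q qv eqy]] := nbrP _ _ yN.
have qy : q \in reach y.
  apply: reach_step (reach_refl y) _ (leq_trans (ltnW yv) (reach_later qv)).
  by rewrite e_sym.
have sub : {subset reach v <= reach y}.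
  have vq : connect (later v) q =1 connect (later v) v.
    move=> z; rewrite inE in qv; apply: same_connect; first exact: later_sym.
    by rewrite later_sym.
  move=> z; rewrite !inE -vq => qz; rewrite inE in qy.
  apply: connect_trans qy _; apply: connect_sub z qz => p1 p2 /and3P[ep va vb].
  apply: connect1; rewrite /later ep.
  by rewrite (leq_trans (ltnW yv) va) (leq_trans (ltnW yv) vb).
apply/nbrP; split; last by exists p => //; apply: sub.
by apply/negP => /reach_later; rewrite leqNgt xy.
Qed.

(** The two neighbours on the cycle of its last vertex [c i] are joined by [fill_nbr], which is a
    chord. The rest is arithmetic of cyclic indices. *)
Lemma fill_chordal : chordal fill.
Proof.
move=> [|n] // c n4 [cI cH].
pose i := [arg max_(j > ord0 : 'I_n.+1) index (c j) s].
have imax j : (index (c j) s <= index (c i) s)%N.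
  by rewrite /i; case: arg_maxnP => // i0 _; apply.
pose a := ordS i; pose b := ord_pred i.
have nextE (j : 'I_n.+1) : ordS j = (if j == n :> nat then 0 else j.+1)%N :> nat.
  rewrite /=; case: eqP => [->|jn]; first by rewrite modnn.
  by rewrite modn_small //; have := ltn_ord j; lia.
have aN : c a \in nbr (reach (c i)).
  by apply: fill_last => //; rewrite cH eqxx orbT.
have bN : c b \in nbr (reach (c i)).
  by apply: fill_last => //; rewrite cH ord_predK eqxx.
have iE : ordS b = i by rewrite ord_predK.
have bE := nextE b; rewrite iE in bE.
have aE : a = _ :> nat := nextE i; have aE' : val (ordS a) = _ := nextE a.
have ab : a <> b.
  move=> ab; move: aE bE; rewrite ab => ->.
  by case: (i =P n :> nat) => ?; case: eqP; lia.
have : fill (c a) (c b) by apply: fill_nbr aN bN _; apply/eqP => /cI.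
rewrite cH iE -!(inj_eq val_inj) aE'; clearbody a b; rewrite /=.
case: (a =P n :> nat) aE bE => ?; case: (i =P n :> nat) => ?;
  case: (b =P n :> nat) => ?; lia.
Qed.

(** All members of a clique but the last one, [v], are neighbours of [reach v]. *)
Lemma fill_clique_number : (clique_number fill <= k.+1)%N.
Proof.
apply/bigmax_leqP => A /forall_inP Acl.
have [->|/set0Pn[x xA]] := eqVneq A set0; first by rewrite cards0.
pose v := [arg max_(y > x in A) index y s].
have [vA vmax] : v \in A /\ {in A, forall y, index y s <= index v s}%N.
  by rewrite /v; case: arg_maxnP => // v0 v0A H; split.
rewrite (cardsD1 v) vA add1n ltnS; apply: leq_trans (card_nbr_reach v).
apply/subset_leq_card/subsetP => y; rewrite in_setD1 => /andP[yv yA].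
apply: fill_last (vmax _ yA).
by have /forall_inP/(_ v vA) := Acl y yA; rewrite yv.
Qed.

End FillIn.
End Elimination.

(** * Chip firing *)

Section ChipFiring.
Variable G : multigraph.
Implicit Types (D : divisor G) (u v w q : vertex G) (C K U : {set vertex G}).

Notation nbr := (nbr (@adjacent G)).

Lemma edgesC u v : edges u v = edges v u.
Proof. by rewrite /edges setUC. Qed.

Lemma adjacent_sym : symmetric (@adjacent G).
Proof. by move=> u v; rewrite /adjacent /= edgesC. Qed.

Lemma adjacent_irr : irreflexive (@adjacent G).
Proof.
move=> u; apply/negbTE/negP => /set0Pn[d]; rewrite inE => /eqP E.
by have := card_ends d; rewrite E setUid cards1.
Qed.

Lemma adjacentE u v : adjacent u v = (0 < #|edges u v|)%N.
Proof. by rewrite card_gt0. Qed.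

(** This is $D - Qx$, with the rows of the Laplacian regrouped as differences of [x] across edges,
    so that signs can be read off. *)
Definition fire D (x : vertex G -> int) : divisor G :=
  [ffun v => D v - \sum_u #|edges v u|%:Z * (x v - x u)].

Definition fire_set D U := fire D (fun u => (u \in U)%:Z).

Lemma laplacian_row_sum v : \sum_u laplacian v u = 0.
Proof.
rewrite -[RHS](laplacian_col_sum v); apply: eq_bigr => u _.
by rewrite /laplacian eq_sym edgesC; case: eqP => // ->.
Qed.

Lemma laplacian_sumE (x : vertex G -> int) v :
  \sum_u laplacian v u * x u = \sum_u #|edges v u|%:Z * (x v - x u).
Proof.
transitivity (\sum_u laplacian v u * (x u - x v)).
  under [RHS]eq_bigr do rewrite mulrBr.
  by rewrite sumrB -mulr_suml laplacian_row_sum mul0r subr0.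
apply: eq_bigr => u _; rewrite /laplacian; case: eqP => [->|_].
  by rewrite subrr !mulr0.
by rewrite mulNr -mulrN opprB.
Qed.

Lemma equivalent_fire D (x : vertex G -> int) : equivalent D (fire D x).
Proof.
exists [ffun u => x u] => v; rewrite !ffunE laplacian_sumE !ffunE.
rewrite opprB addrC subrK; by apply: eq_bigr => u _; rewrite ffunE.
Qed.

Lemma equivalent_trans D1 D2 D3 :
  equivalent D1 D2 -> equivalent D2 D3 -> equivalent D1 D3.
Proof.
move=> [x Ex] [y Ey]; exists (x + y) => v.
under eq_bigr do rewrite ffunE mulrDr.
by rewrite big_split /= -Ex -Ey !ffunE addrA subrK.
Qed.

Lemma equivalent_sym D1 D2 : equivalent D1 D2 -> equivalent D2 D1.
Proof.
move=> [x Ex]; exists (- x) => v.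
under eq_bigr do rewrite ffunE mulrN.
by rewrite sumrN -Ex !ffunE opprB.
Qed.

(** Adding a constant to [x] does not change $Qx$, so [x] can be made nonnegative; its sum then
    serves as a measure for induction. *)
Lemma equivalent_fireP D D' : equivalent D D' ->
  exists x : vertex G -> nat, D' = fire D (fun u => (x u)%:Z).
Proof.
case=> x Ex; pose b : int := \sum_w `|x w|.
have xb u : 0 <= x u + b.
  rewrite -(opprK b) subr_ge0; apply: le_trans (lerNnormlW (lexx _)).
  rewrite lerN2 /b (bigD1 u) //= lerDl; exact: sumr_ge0.
exists (fun u => absz (x u + b)); apply/ffunP => v; rewrite ffunE.
have := Ex v; rewrite !ffunE laplacian_sumE => E.
rewrite -[D' v](subKr (D v)) E; congr (_ - _); apply: eq_bigr => u _.
by rewrite !abszE !ger0_norm // opprD addrACA subrr addr0.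
Qed.

Lemma fire_fire D x y : fire (fire D x) y = fire D (fun u => x u + y u).
Proof.
apply/ffunP => v; rewrite !ffunE -addrA -opprD -big_split; congr (_ - _).
by apply: eq_bigr => u _; rewrite /= -mulrDr opprD addrACA.
Qed.

Lemma fire_set_in D U v : v \in U ->
  fire_set D U v = D v - \sum_(u | u \notin U) #|edges v u|%:Z.
Proof.
move=> vU; rewrite ffunE vU [in RHS]big_mkcond; congr (_ - _).
apply: eq_bigr => u _; case: (u \in U); first by rewrite subrr mulr0.
by rewrite subr0 mulr1.
Qed.

Lemma fire_set_notin D U v : v \notin U ->
  fire_set D U v = D v + \sum_(u in U) #|edges v u|%:Z.
Proof.
move=> /negbTE vU; rewrite ffunE vU [in RHS]big_mkcond -sumrN; congr (_ + _).
apply: eq_bigr => u _; case: (u \in U); last by rewrite subrr mulr0 oppr0.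
by rewrite sub0r mulrN1 opprK.
Qed.

Lemma fire_set_gt D U v u : v \notin U -> u \in U -> adjacent v u ->
  effective D -> 0 < fire_set D U v.
Proof.
move=> vU uU; rewrite adjacentE fire_set_notin // => vu D0.
rewrite (bigD1 u) //= addrCA; apply: ltr_wpDr; last by rewrite ltz_nat.
by rewrite addr_ge0 // sumr_ge0.
Qed.

Lemma fire_set_ge D U v : v \notin U -> D v <= fire_set D U v.
Proof. by move=> vU; rewrite fire_set_notin // lerDl sumr_ge0. Qed.

(** [x] drops by at least 1 along each edge leaving the set, so a vertex of the set loses no more
    chips than under [x]. The other vertices lose none. *)
Lemma fire_argmax D (x : vertex G -> nat) (m : nat) :
  (forall u, x u <= m)%N -> effective D ->
  effective (fire D (fun u => (x u)%:Z)) ->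
  effective (fire_set D [set u | x u == m]).
Proof.
move=> xm D0 Dx v; have [vU|vU] := boolP (v \in [set u | x u == m]); last first.
  exact: le_trans (D0 v) (fire_set_ge _ vU).
apply: le_trans (Dx v) _; rewrite !ffunE lerD2l lerN2.
apply: ler_sum => u _; apply: ler_wpM2l => //; rewrite vU.
by move: vU; rewrite !inE; have := xm u; case: eqP; lia.
Qed.

Lemma fire_max_le D (x : vertex G -> nat) v :
  (forall u, x u <= x v)%N -> fire D (fun u => (x u)%:Z) v <= D v.
Proof.
move=> xv; rewrite ffunE gerBl sumr_ge0 // => u _.
by rewrite mulr_ge0 // subr_ge0 lez_nat.
Qed.

(* The chips of [U] pay for the vertices of [C :\: K] and for the neighbours of
   [K] in [U], since each of them accounts for an edge leaving [U]. *)
Lemma card_nbr_le D U C K : effective D -> effective (fire_set D U) ->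
  {in nbr C, forall w, 0 < D w} -> [disjoint C & U] -> K \subset C ->
  {in C :\: K, forall v, exists2 u, u \in U & adjacent u v} ->
  #|nbr K|%:Z <= deg D.
Proof.
move=> D0 DU CD CU KC CK.
pose T := C :\: K.
have Cout v : v \in C -> v \notin U by move=> vC; rewrite (disjointFr CU).
(* Firing costs [u] a chip per edge leaving [U]. Edges into [K] pay for [u] itself, edges into [T]
   for the vertices of [T]. *)
have NU u : u \in U -> (u \in nbr K)%:Z + \sum_(t in T) #|edges u t|%:Z <= D u.
  move=> uU; have := DU u; rewrite fire_set_in // subr_ge0; apply: le_trans.
  have: \sum_(t in C) #|edges u t|%:Z <= \sum_(v | v \notin U) #|edges u v|%:Z.
    rewrite big_mkcond [leRHS]big_mkcond; apply: ler_sum => v _.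
    by case: (boolP (v \in C)) => [/Cout ->|_] //; case: ifP.
  apply: le_trans; rewrite [leRHS](big_setID K) (setIidPr KC) /= lerD2r.
  case: nbrP => [[_ [v vK]]|_]; last exact: sumr_ge0.
  rewrite adjacent_sym adjacentE (bigD1 v) //= => uv.
  by apply: ler_wpDr; [exact: sumr_ge0 | rewrite lez_nat].
(* A neighbour of [K] outside [C] is a neighbour of [C] and has a chip; one inside [C] lies in [T]
   and is cancelled. *)
have NUC w : w \notin U -> (w \in nbr K)%:Z - (w \in T)%:Z <= D w.
  move=> wU; have := D0 w; case: nbrP => [[wK [v vK vw]]|_]; last first.
    by case: (w \in T) => //=; lia.
  rewrite inE wK /=; case: (boolP (w \in C)) => //= wC _.
  rewrite subr0 -gtz0_ge1; apply: CD; apply/nbrP; split=> //.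
  by exists v => //; apply: (subsetP KC).
have TE : \sum_(w | w \notin U) (w \in T)%:Z <=
    \sum_(u in U) \sum_(t in T) #|edges u t|%:Z.
  rewrite exchange_big big_mkcond [leRHS]big_mkcond; apply: ler_sum => w _.
  case: (boolP (w \in T)) => [/CK[u uU]|_]; last by case: ifP.
  rewrite adjacentE (bigD1 u) //= => uw; apply: le_trans (_ : 1 <= _).
    by case: ifP.
  by apply: ler_wpDr; [exact: sumr_ge0 | rewrite lez_nat].
have -> : #|nbr K|%:Z = \sum_w (w \in nbr K)%:Z.
  rewrite -sum1_card big_mkcond (big_morph Posz PoszD (erefl _)).
  by apply: eq_bigr => w _; case: ifP.
rewrite /deg (bigID (mem U)) [leRHS](bigID (mem U)) /=.
have : \sum_(u in U) ((u \in nbr K)%:Z + \sum_(t in T) #|edges u t|%:Z)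
    <= \sum_(u in U) D u by apply: ler_sum => u; apply: NU.
have : \sum_(w | w \notin U) ((w \in nbr K)%:Z - (w \in T)%:Z)
    <= \sum_(w | w \notin U) D w by apply: ler_sum => w; apply: NUC.
rewrite sumrB big_split /= => H2 H1.
have : forall a b c d p q : int,
  c <= d -> b - c <= q -> a + d <= p -> a + b <= p + q by lia.
by apply; [exact: TE | exact: H2 | exact: H1].
Qed.

(** * Elimination orders from divisors of positive rank *)

Definition positive_rank D : Prop :=
  forall q, exists D', [/\ equivalent D D', effective D' & 0 < D' q].

Lemma rank_gt0_positive D : 0 < rank D -> positive_rank D.
Proof.
rewrite /rank; case: pselect => // eD.
case: ex_maxnP => m /asboolP Dm _; rewrite ltz_nat => m0 q.
(* Removing [m] chips at [q] and adding them back to an effective divisor leaves at least [m]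
   there. *)
have [||E DE E0] := Dm [ffun v => if v == q then m%:Z else 0].
- by move=> v; rewrite ffunE; case: ifP.
- rewrite /deg (bigD1 q) //= ffunE eqxx big1 ?addr0 // => v /negbTE vq.
  by rewrite ffunE vq.
exists [ffun v => E v + if v == q then m%:Z else 0]; split.
- by case: DE => x Ex; exists x => v; rewrite -Ex !ffunE opprD addrA addrAC.
- by move=> v; rewrite ffunE; apply: addr_ge0 => //; case: ifP.
- by rewrite ffunE eqxx; apply: ltr_wpDl.
Qed.

Lemma positive_rank_equivalent D D' :
  equivalent D D' -> positive_rank D -> positive_rank D'.
Proof.
move=> DD' Dr q; have [D'' [E D''0 D''q]] := Dr q; exists D''; split=> //.
exact: equivalent_trans (equivalent_sym DD') E.
Qed.

Lemma card_le_deg D (A : {set vertex G}) : effective D ->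
  {in A, forall w, 0 < D w} -> #|A|%:Z <= deg D.
Proof.
move=> D0 AD; rewrite -sum1_card (big_morph Posz PoszD (erefl _)) /deg.
rewrite big_mkcond; apply: ler_sum => w _.
by case: ifP => // /AD; rewrite gtz0_ge1.
Qed.

Lemma elimination (k : nat) D C : effective D -> positive_rank D ->
  deg D = k%:Z -> {in nbr C, forall w, 0 < D w} ->
  exists s, [/\ uniq s, s =i C & narrow (@adjacent G) k s].
Proof.
have [n] := ubnP #|C|; elim: n C D => // n IH C D Cn D0 Dr Dk CD.
have [->|/set0Pn[q qC]] := eqVneq C set0.
  by exists [::]; split=> // x; rewrite inE.
have [D' [/equivalent_fireP[x ->] Dx0 Dxq]] := Dr q.
(* Inner induction on the total of [x], while [C] stays fixed. *)
have [m] := ubnP (\sum_u x u)%N.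
elim: m D x D0 Dr Dk CD Dx0 Dxq => // m IHm D x D0 Dr Dk CD Dx0 Dxq xm.
have [[c /andP[cC Dc]]|noC] := pselect (exists c, (c \in C) && (0 < D c)).
  have CcD : {in nbr (C :\ c), forall w, 0 < D w}.
    move=> w /nbrP[]; rewrite !inE negb_and negbK => /orP[/eqP-> //|wC].
    by case=> u /setD1P[_ uC] uw; apply: CD; apply/nbrP; split=> //; exists u.
  have [|s [us sC ns]] := IH (C :\ c) D _ D0 Dr Dk CcD.
    by move: Cn; rewrite (cardsD1 c) cC.
  exists (c :: s); split.
  - by rewrite /= us sC !inE eqxx.
  - by move=> y; rewrite inE sC !inE; case: eqVneq => [->|].
  apply: (@narrow_prepend _ _ _ [:: c]) => // K sK Ks.
  rewrite -lez_nat -Dk; apply: card_le_deg => // w /nbrP[wK [u uK uw]].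
  have [-> //|wc] := eqVneq w c.
  have wC : w \notin C.
    by apply: contra wK => wC; apply: sK; rewrite sC !inE wc.
  apply: CD; apply/nbrP; split=> //; exists u => //.
  by have := Ks u uK; rewrite inE sC !inE; case: eqVneq => [->|].
have Cno c : c \in C -> D c = 0.
  move=> cC; apply/eqP; rewrite eq_le D0 andbT leNgt; apply/negP => Dc.
  by case: noC; exists c; rewrite cC.
pose v := [arg max_(u > q) x u].
have xv u : (x u <= x v)%N by rewrite /v; case: arg_maxnP => // i _; apply.
pose U := [set u | x u == x v].
have U0 : effective (fire_set D U) by apply: fire_argmax.
(* Where [x] is maximal, firing [x] gains no chips, but [q] has none in [D] and must end with
   one. *)
have qU : q \notin U.
  rewrite inE; apply/negP => /eqP qv.
  have := @fire_max_le D x q; rewrite qv (Cno _ qC) => /(_ xv).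
  by rewrite leNgt Dxq.
have v_gt0 : (0 < x v)%N.
  apply: leq_ltn_trans (leq0n (x q)) _; rewrite ltn_neqAle xv.
  by move: qU; rewrite inE => ->.
(* An edge from the chipless [c] out of [U] would put [c] in debt after firing [U]. *)
have CU c w : c \in C -> c \in U -> adjacent c w -> w \in U.
  move=> cC cU; rewrite adjacentE => cw; apply/negPn/negP => wU.
  have := U0 c; rewrite fire_set_in // Cno // (bigD1 w) //= sub0r oppr_ge0.
  apply/negP; rewrite -ltNge; apply: ltr_wpDr; last by rewrite ltz_nat.
  exact: sumr_ge0.
have [/set0Pn[c /setIP[cC cU]]|CU0] := boolP (C :&: U != set0).
  have split1 (A B : {set vertex G}) : A \proper C -> A :|: B = C ->
      {in A & B, forall u w, ~~ adjacent u w} ->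
      exists s, [/\ uniq s, s =i A & narrow (@adjacent G) k s].
    move=> AC AB AnB; apply: (IH _ D) => //.
      by apply: leq_trans (proper_card AC) _.
    (* A neighbour of [A] is not in [B], so it is a neighbour of [C] and the same divisor serves. *)
    move=> w /nbrP[wA [u uA uw]]; apply: CD; apply/nbrP; split.
      rewrite -AB inE (negbTE wA); apply: contraL uw; exact: AnB.
    by exists u; rewrite // -AB inE uA.
  have AB : {in C :&: U & C :\: U, forall u w, ~~ adjacent u w}.
    move=> u w /setIP[uC uU] /setDP[_]; apply: contra; exact: CU.
  have [||s1 [us1 s1E ns1]] := split1 (C :&: U) (C :\: U) _ _ AB.
  - rewrite properE subsetIl; apply/subsetPn; exists q => //.
    by rewrite inE (negbTE qU) andbF.
  - exact: setID.
  have [|||s2 [us2 s2E ns2]] := split1 (C :\: U) (C :&: U).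
  - rewrite properE subsetDl; apply/subsetPn; exists c => //.
    by rewrite inE cU.
  - by rewrite setUC setID.
  - by move=> u w uA wA; rewrite adjacent_sym; apply: AB.
  exists (s1 ++ s2); split.
  - rewrite cat_uniq us1 us2 andbT; apply/hasPn => y.
    by rewrite s2E !inE s1E !inE => /andP[/negbTE -> _]; rewrite andbF.
  - by move=> y; rewrite mem_cat s1E s2E -in_setU setID.
  by apply: narrow_cat => // u w; rewrite s1E s2E; apply: AB.
have CdU : [disjoint C & U] by rewrite -setI_eq0; apply: negPn.
have notU c : c \in C -> c \notin U by move=> cC; rewrite (disjointFr CdU).
have Dr' : positive_rank (fire_set D U).
  by apply: positive_rank_equivalent Dr; apply: equivalent_fire.
have Dk' : deg (fire_set D U) = k%:Z.
  by rewrite -Dk; apply/esym/deg_equivalent/equivalent_fire.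
pose R := [set c in C | [exists u in U, adjacent u c]].
have RP c : c \in C -> reflect (exists2 u, u \in U & adjacent u c) (c \in R).
  by move=> cC; rewrite inE cC; apply: exists_inP.
(* Vertices of [R] receive a chip from [U]. A neighbour outside [C] is not in [U], since its
   neighbour [c] would then be in [R], so it keeps its chip. *)
have CRD : {in nbr (C :\: R), forall w, 0 < fire_set D U w}.
  move=> w /nbrP[wCR [c /setDP[cC cR] cw]]; have [wC|wC] := boolP (w \in C).
    have : w \in R by move: wCR; rewrite inE wC andbT negbK.
    case/(RP _ wC) => u uU uw.
    by apply: (fire_set_gt (notU _ wC) uU) => //; rewrite adjacent_sym.
  have wU : w \notin U.
    by apply: contra cR => wU; apply/RP => //; exists w; rewrite 1?adjacent_sym.
  apply: lt_le_trans (fire_set_ge D wU).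
  by apply: CD; apply/nbrP; split=> //; exists c.
have [R0|/set0Pn[r rR]] := eqVneq R set0.
  have CR : C :\: R = C by rewrite R0 setD0.
  (* What remains to be fired after [U]; the truncated subtraction is exact because [x] is positive
     on [U]. *)
  pose y u := (x u - (u \in U))%N.
  have yE : fire (fire_set D U) (fun u => (y u)%:Z) = fire D (fun u => (x u)%:Z).
    rewrite /fire_set fire_fire; congr fire; apply/funext => u.
    rewrite -PoszD subnKC //; case: (boolP (u \in U)) => //.
    by rewrite inE => /eqP ->.
  rewrite CR in CRD.
  apply: (IHm (fire_set D U) y) => //; rewrite ?yE //.
  move: xm; rewrite ltnS; apply: leq_trans.
  rewrite (bigD1 v) //= [leqRHS](bigD1 v) //= -addSn.
  apply: leq_add; first by rewrite /y inE eqxx subn1 prednK.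
  by apply: leq_sum => u _; apply: leq_subr.
have [|s [us sE ns]] := IH _ _ _ U0 Dr' Dk' CRD.
  apply: leq_trans (_ : #|C| <= n)%N => //.
  apply: proper_card; rewrite properE subsetDl; apply/subsetPn; exists r.
    by move: rR; rewrite inE => /andP[].
  by rewrite inE rR.
have RC : R \subset C by apply/subsetP => c; rewrite inE => /andP[].
exists (enum R ++ s); split.
- rewrite cat_uniq enum_uniq us andbT; apply/hasPn => y.
  by rewrite sE inE mem_enum => /andP[].
- move=> y; rewrite mem_cat mem_enum sE in_setD.
  by case: (boolP (y \in R)) => [/(subsetP RC) ->|].
apply: narrow_prepend => // K sK Ks.
rewrite -lez_nat -Dk; apply: (card_nbr_le D0 U0 CD CdU).
  apply/subsetP => y /Ks; rewrite mem_cat mem_enum sE => /orP[/(subsetP RC) //|].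
  by case/setDP.
(* [K] contains all of [C :\: R], so every vertex of [C :\: K] lies in [R] and is adjacent to
   [U]. *)
move=> y /setDP[yC yK]; apply/RP => //; apply: contraR yK => yR.
by apply: sK; rewrite sE inE yR.
Qed.

End ChipFiring.

Theorem theorem2p1 (G : multigraph) (hG : connected G) :
  treewidth G <= (gonality G)%:Z.
Proof.
rewrite /gonality; case: ex_minnP => k /asboolP[D0 D0k D0r] _.
have /card_gt0P[v0 _] := card_vertex_gt0 G.
have D0p := rank_gt0_positive D0r.
(* Positive rank at any vertex supplies an effective divisor in the class to start the search. *)
have [D [D0D Deff _]] := D0p v0.
have Dp := positive_rank_equivalent D0D D0p.
have Dk : deg D = k%:Z by rewrite -D0k (deg_equivalent D0D).
have [|s [us sE ns]] := @elimination _ k D setT Deff Dp Dk.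
  by move=> w /nbrP[]; rewrite inE.
have sT v : v \in s by rewrite sE inE.
have symG := @adjacent_sym G; have irrG := @adjacent_irr G.
pose H := fill (@adjacent G) s.
have Hext : chordal_extension H.
  split; [exact: fill_simple | exact: fill_chordal | exact: fill_extends].
have Hk : (clique_number H <= k.+1)%N by apply: fill_clique_number.
rewrite /treewidth; case: ex_minnP => t _ /(_ (clique_number H)) tH.
have : (t <= clique_number H)%N by apply/tH/asboolP; exists H.
lia.
Qed.
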